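(* For every $0<u\leq 1$, every $p>0$ and every $\epsilon>0$ one has, for all $N\geq 2$, $$\mathcal{I}_{p,2}(u;N)\ll N^{\epsilon}\left(N^{p-3}+N^{p/2-u}\right),$$ where the implicit constant may depend on $p,u,\epsilon$ but not on $N$.
   Context: For $d\geq 2$, $\boldsymbol{\alpha}=(\alpha_d,\ldots,\alpha_1)\in\mathbb{R}^d$ and $N\geq 1$, let $f_d(\boldsymbol{\alpha};N)=\sum_{1\leq n\leq N}e(\alpha_d n^d+\cdots+\alpha_1 n)$, where $e(x)=e^{2\pi i x}$. For $p>0$ and $u>0$ let $$\mathcal{I}_{p,d}(u;N)=\int_{[0,1)\times[0,N^{-u})\times[0,1)^{d-2}}|f_d(\boldsymbol{\alpha};N)|^p\,d\boldsymbol{\alpha},$$ where the first coordinate is $\alpha_d$, the second is $\alpha_{d-1}$ (restricted to $[0,N^{-u})$), and $d\boldsymbol{\alpha}=d\alpha_1\cdots d\alpha_d$. For $d=2$ the domain is $[0,1)\times[0,N^{-u})$ with $\alpha_2\in[0,1)$, $\alpha_1\in[0,N^{-u})$. *)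

(* Defs.v *)
From mathcomp Require Import all_boot all_order all_algebra.
From mathcomp Require Import complex.
From mathcomp Require Import all_classical all_reals all_analysis.

Set Implicit Arguments.
Unset Strict Implicit.
Unset Printing Implicit Defensive.

Import Order.TTheory GRing.Theory Num.Theory.
Import numFieldNormedType.Exports.

Local Open Scope classical_set_scope.
Local Open Scope ring_scope.
Local Open Scope complex_scope.

(* e(x) = exp(2 pi i x), written through Euler's formula. *)
Definition e2pii (R : realType) (x : R) : R[i] :=
  cos (2 * pi * x) +i* sin (2 * pi * x).

(* The coefficients are listed as (alpha_d, ..., alpha_1): the entry of index i
   is the coefficient of n ^ (d - i). *)
Definition weyl_sum (R : realType) (d : nat) (alpha : d.-tuple R) (N : nat) :
    R[i] :=
  \sum_(1 <= n < N.+1) e2pii (\sum_(i < d) tnth alpha i * n%:R ^+ (d - i)).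

(* Points of R * R are read as (alpha_2, alpha_1), so the short range is that of
   alpha_1. *)
Definition weyl_sum2 (R : realType) (alpha : R * R) (N : nat) : R[i] :=
  weyl_sum [tuple alpha.1; alpha.2] N.

Definition short_box2 (R : realType) (u : R) (N : nat) : set (R * R) :=
  `[0, 1[ `*` `[0, N%:R `^ (- u)[.

(* [normc] is the modulus with values in R; the norm `|z| of z : R[i] has values
   in R[i]. *)
Definition mean_value2 (R : realType) (p u : R) (N : nat) : \bar R :=
  (\int[lebesgue_measure \x lebesgue_measure]_(alpha in short_box2 u N)
    (ComplexField.Normc.normc (weyl_sum2 alpha N) `^ p)%:E)%E.

(* Main.v *)
(* Write f for the Weyl sum, n for N and D_M(z) = |sum_(m < M) e(m z)|.  It is
   enough to treat the exponent 6 - 2 u at which the two terms of the bound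
   agree: larger and smaller exponents reduce to it by |f| <= n and by splitting
   at |f| = sqrt n.  Write |f|^(6 - 2 u) = (|f|^2)^(2 - u) |f|^2 and put
   E_h(x) = D_(N - h)(2 h x).  Differencing bounds |f(x, y)|^2, uniformly in y,
   by 2 (n + S(x)) with S = sum_(0 < h < N) E_h; majorising the short interval by
   a Fejer kernel of length K ~ n^u bounds the y-mean of the remaining |f|^2 by a
   multiple of n^(-u) (n + T(x)) with T = sum_(0 < h < K) E_h.  Since S <= n^2,
     (n + S)^(2 - u) (n + T) << n^(3 - u) + n^(1 - u) S^2 + n^(2 - 2 u) S T,
   so that no Diophantine approximation is needed, only the bilinear estimate
   \int_0^1 S T << n K (log n)^4 and its case K = N.  For this, D_M is dominated
   pointwise by the Fejer average sum_(M <= N) D_M^2 / M^2, whose products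
   integrate, by orthogonality, to counts of the solutions of h m = k l; these
   solutions are parametrised by h = d h', k = d k', m = k' t, l = h' t. *)

Require Import Defs.
From mathcomp Require Import all_boot all_order all_algebra complex.
From mathcomp Require Import all_classical all_reals all_analysis measurable_realfun.
From mathcomp Require Import ring lra zify.

Set Implicit Arguments.
Unset Strict Implicit.
Unset Printing Implicit Defensive.

Import Order.TTheory GRing.Theory Num.Theory.
Import numFieldNormedType.Exports.
Import ComplexField.Normc.

Local Open Scope ring_scope.

(** * Exponential sums and the Dirichlet kernel *)

Section Trig.
Variable R : realType.
Implicit Types x y : R.

Lemma e2piiD x y : e2pii (x + y) = e2pii x * e2pii y.
Proof.
rewrite /e2pii mulrDr cosD sinD; apply/eqP; rewrite eq_complex /=.
by rewrite eqxx /= [sin _ * _ + _]addrC eqxx.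
Qed.

Lemma normc_ge0 (z : R[i]) : 0 <= normc z.
Proof. by case: z => a b; exact: sqrtr_ge0. Qed.

Lemma normc_sqr (z : R[i]) : normc z ^+ 2 = complex.Re z ^+ 2 + complex.Im z ^+ 2.
Proof. by case: z => a b /=; rewrite sqr_sqrtr // addr_ge0 ?sqr_ge0. Qed.

Lemma normc_e2pii x : normc (e2pii x) = 1.
Proof. by rewrite /= cos2Dsin2 sqrtr1. Qed.

Lemma e2piin x (n : nat) : e2pii (n%:R * x) = e2pii x ^+ n.
Proof.
elim: n => [|n IHn]; last by rewrite exprS -IHn -e2piiD -natr1 mulrDl mul1r addrC.
by rewrite mul0r /e2pii mulr0 cos0 sin0.
Qed.

Lemma normc_sum (I : Type) (r : seq I) (P : pred I) (F : I -> R[i]) :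
  normc (\sum_(i <- r | P i) F i) <= \sum_(i <- r | P i) normc (F i).
Proof.
elim/big_ind2: _ => [|x a y b xa yb|//]; first by rewrite normc0.
by apply: le_trans (le_normcD _ _) _; apply: lerD.
Qed.

Lemma Re_sum (I : Type) (r : seq I) (P : pred I) (F : I -> R[i]) :
  complex.Re (\sum_(i <- r | P i) F i) = \sum_(i <- r | P i) complex.Re (F i).
Proof. by elim/big_rec2: _ => // i a b _ <-; case: (F i) b => ? ? []. Qed.

Lemma Im_sum (I : Type) (r : seq I) (P : pred I) (F : I -> R[i]) :
  complex.Im (\sum_(i <- r | P i) F i) = \sum_(i <- r | P i) complex.Im (F i).
Proof. by elim/big_rec2: _ => // i a b _ <-; case: (F i) b => ? ? []. Qed.

(** Squaring real and imaginary parts pairs the terms through the subtraction formula for the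
    cosine; the imaginary parts of the pairs cancel. *)
Lemma normc_expsum_sqr (I : finType) (t : I -> R) :
  normc (\sum_i e2pii (t i)) ^+ 2 =
  \sum_i \sum_j cos (2 * pi * (t i - t j)).
Proof.
rewrite normc_sqr Re_sum Im_sum /= !expr2 !mulr_suml -big_split /=.
apply: eq_bigr => i _; rewrite !mulr_sumr -big_split /=.
by apply: eq_bigr => j _; rewrite mulrBr cosB.
Qed.

(** A common phase [c] only rotates the sum, and a real part is at most the modulus. This is what
    makes later bounds uniform in the linear coefficient. *)
Lemma cos_sum_le (I : finType) (P : pred I) (t : I -> R) c :
  `|\sum_(i | P i) cos (2 * pi * (t i + c))| <=
  normc (\sum_(i | P i) e2pii (t i)).
Proof.
have -> : \sum_(i | P i) cos (2 * pi * (t i + c)) =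
    complex.Re (e2pii c * \sum_(i | P i) e2pii (t i)).
  rewrite mulr_sumr Re_sum; apply: eq_bigr => i _.
  by rewrite -e2piiD addrC.
rewrite -[leRHS]mul1r -(normc_e2pii c) -normcM.
rewrite -ler_sqr ?nnegrE ?normc_ge0 // normc_sqr real_normK ?num_real //.
by rewrite lerDl sqr_ge0.
Qed.

Lemma norm_sin_le x : `|sin x| <= `|x|.
Proof.
have [->|x0] := eqVneq x 0; first by rewrite sin0.
have dsin (t : R) : is_derive t 1 (@sin R : R -> R) (cos t) by exact: is_derive_sin.
have csin : forall a b, {within `[a, b], continuous (@sin R)}%classic.
  by move=> a b; apply: continuous_subspaceT; exact: continuous_sin.
have [xlt|xgt|xE] := ltgtP x 0; last by rewrite xE eqxx in x0.
  have [c _] := MVT xlt (fun t _ => dsin t) (csin x 0).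
  rewrite sin0 !sub0r => /(congr1 Num.norm); rewrite normrM !normrN => ->.
  by rewrite ler_piMl ?cos_max.
have [c _] := MVT xgt (fun t _ => dsin t) (csin 0 x).
rewrite sin0 !subr0 => ->; rewrite normrM.
by rewrite ler_piMl ?cos_max.
Qed.

Lemma normc_1Be2pii x : normc (1 - e2pii x) <= 2 * pi * `|x|.
Proof.
have -> : normc (1 - e2pii x) = 2 * `|sin (pi * x)|.
  have E : normc (1 - e2pii x) ^+ 2 = (2 * `|sin (pi * x)|) ^+ 2.
    rewrite normc_sqr /= sub0r sqrrN.
    have -> : 2 * pi * x = (pi * x) *+ 2 by rewrite -[RHS]mulr_natl mulrA.
    rewrite exprMn real_normK ?num_real // cos_mulr2n sin_mulr2n.
    have := cos2Dsin2 (pi * x); set c := cos _; set s := sin _ => cs.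
    have -> : c ^+ 2 = 1 - s ^+ 2 by rewrite -cs addrK.
    have -> : (c * s *+ 2) ^+ 2 = 4 * c ^+ 2 * s ^+ 2 by rewrite -mulr_natr; ring.
    have -> : c ^+ 2 = 1 - s ^+ 2 by rewrite -cs addrK.
    by rewrite -mulr_natr; ring.
  apply: (@pexpIrn _ 2) => //; rewrite ?nnegrE ?normc_ge0 ?mulr_ge0 //.
rewrite -mulrA ler_wpM2l //.
have -> : pi * `|x| = `|pi * x| by rewrite normrM (ger0_norm (pi_ge0 R)).
exact: norm_sin_le.
Qed.

Definition dirichlet (M : nat) x : R := normc (\sum_(m < M) e2pii (m%:R * x)).

Lemma dirichlet_ge0 M x : 0 <= dirichlet M x.
Proof. exact: normc_ge0. Qed.

Lemma dirichlet_le M x : dirichlet M x <= M%:R.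
Proof.
apply: le_trans (normc_sum _ _ _) _.
under eq_bigr do rewrite normc_e2pii.
by rewrite sumr_const card_ord.
Qed.

(** Telescoping of the geometric sum. Here and below [normc (1 - e2pii x)] stands in for the
    distance from [x] to the nearest integer. *)
Lemma dirichlet_geometric M x : dirichlet M x * normc (1 - e2pii x) <= 2.
Proof.
rewrite -normcM mulrC.
under eq_bigr do rewrite e2piin.
have -> : (1 - e2pii x) * \sum_(i < M) e2pii x ^+ i = 1 - e2pii x ^+ M.
  rewrite -[1 in RHS](expr1n _ M) subrXX; congr (_ * _).
  by apply: eq_bigr => i _; rewrite expr1n mul1r.
apply: le_trans (le_normcD _ _) _.
by rewrite normcN normc1 -e2piin normc_e2pii.
Qed.

Lemma normc_1Be2piiX x m : normc (1 - e2pii x ^+ m) <= m%:R * normc (1 - e2pii x).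
Proof.
rewrite -[1 in leLHS](expr1n _ m) subrXX normcM mulrC.
apply: ler_wpM2r; first exact: normc_ge0.
apply: le_trans (normc_sum _ _ _) _.
under eq_bigr do rewrite expr1n mul1r -e2piin normc_e2pii.
by rewrite sumr_const card_ord.
Qed.

(** With [d] the distance, the term of index [m] differs from 1 by at most [m d], so the whole sum
    differs from [M] by at most [M^2 d / 2], which is at most [M / 2]. *)
Lemma dirichlet_ge_half M x : M%:R * normc (1 - e2pii x) <= 1 ->
  M%:R / 2 <= dirichlet M x.
Proof.
set d := normc _ => Md.
have d0 : 0 <= d by exact: normc_ge0.
suff : M%:R <= dirichlet M x + M%:R / 2 by lra.
have {1}-> : M%:R = normc (\sum_(m < M) (1 : R[i])).
  rewrite sumr_const card_ord.
  have -> : (1 *+ M : R[i]) = ((M%:R : R)%:C)%C by rewrite rmorph_nat.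
  by rewrite /= expr0n /= addr0 sqrtr_sqr ger0_norm.
have -> : \sum_(m < M) (1 : R[i]) =
  \sum_(m < M) e2pii (m%:R * x) + \sum_(m < M) (1 - e2pii (m%:R * x)).
  by rewrite -big_split /=; apply: eq_bigr => m _; rewrite addrC subrK.
apply: le_trans (le_normcD _ _) _; rewrite lerD2l.
apply: le_trans (normc_sum _ _ _) _.
have : \sum_(m < M) normc (1 - e2pii (m%:R * x)) <= \sum_(m < M) (m%:R * d).
  by apply: ler_sum => m _; rewrite e2piin; exact: normc_1Be2piiX.
move=> /le_trans; apply.
rewrite -mulr_suml -natr_sum.
have S2 : ((\sum_(m < M) (m : nat)) * 2 <= M * M)%N.
  elim: (M) => [|n]; first by rewrite big_ord0.
  rewrite big_ord_recr /=; set s := (\sum_(i < n) i)%N => IHn.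
  rewrite mulnDl; apply: leq_trans (leq_add IHn (leqnn _)) _; nia.
have {}S2 : (\sum_(m < M) (m : nat))%:R * 2 <= M%:R * M%:R :> R.
  by rewrite -!natrM ler_nat.
have : (\sum_(m < M) (m : nat))%:R * 2 * d <= M%:R * M%:R * d.
  by apply: ler_wpM2r.
have : M%:R * (M%:R * d) <= M%:R * 1 by apply: ler_wpM2l.
lra.
Qed.

End Trig.

(** * Domination of Dirichlet kernels by a Fejer average *)

Section Fejer.
Variable R : realType.
Implicit Types x y z : R.

(** Up to the factor [1 / M], each summand is a Fejer kernel. The squares make mean values
    computable by orthogonality, which the modulus [dirichlet] alone does not allow. *)
Definition fejer_sum (N : nat) z : R :=
  \sum_(M < N) (dirichlet M.+1 z / M.+1%:R) ^+ 2.

Lemma fejer_sum_ge0 N z : 0 <= fejer_sum N z.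
Proof. by apply: sumr_ge0 => ? _; exact: sqr_ge0. Qed.

(** Each of the first [P] kernels is at least half its maximum, so each of the first [P] summands is
    at least 1/4. *)
Lemma fejer_sum_ge N P z : (P <= N)%N -> P%:R * normc (1 - e2pii z) <= 1 ->
  P%:R / 4 <= fejer_sum N z.
Proof.
move=> PN Pd; rewrite /fejer_sum -(subnKC PN) big_split_ord /=.
rewrite -[leLHS]addr0; apply: lerD; last first.
  by apply: sumr_ge0 => ? _; exact: sqr_ge0.
have -> : P%:R / 4 = \sum_(M < P) (4^-1 : R).
  by rewrite sumr_const card_ord mulr_natl.
apply: ler_sum => M _.
have M0 : 0 < M.+1%:R :> R by rewrite ltr0n.
have : M.+1%:R / 2 <= dirichlet M.+1 z.
  apply: dirichlet_ge_half; apply: le_trans Pd.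
  by rewrite ler_wpM2r ?normc_ge0 // ler_nat.
rewrite mulrC -ler_pdivlMr // => h.
have -> : 4^-1 = (2^-1) ^+ 2 :> R by lra.
by rewrite ler_sqr ?nnegrE ?divr_ge0 ?dirichlet_ge0.
Qed.

(** Both sides are compared with the minimum of [N] and [1 / d], for [d] the distance to the
    integers, in three ranges: [d >= 1], [d <= 1 / N], and the range in between. *)
Lemma dirichlet_le_fejer_sum N M z : (M <= N)%N ->
  dirichlet M z <= 16 * fejer_sum N z.
Proof.
move=> MN; have [->|M0] := posnP M.
  by rewrite /dirichlet big_ord0 normc0 mulr_ge0 ?fejer_sum_ge0.
have N0 : (0 < N)%N by lia.
have D1 := dirichlet_geometric M z; have DM := dirichlet_le M z.
have {}DM : dirichlet M z <= N%:R by apply: le_trans DM _; rewrite ler_nat.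
set d := normc _ in D1; set D := dirichlet M z in D1 DM *.
have d0 : 0 <= d by exact: normc_ge0.
have D0 : 0 <= D by exact: dirichlet_ge0.
have G0 := fejer_sum_ge0 N z.
have [d1|d1] := leP 1 d.
  have : 1 <= fejer_sum N z.
    rewrite /fejer_sum -(subnKC N0) big_split_ord /= big_ord1 /=.
    rewrite /dirichlet big_ord1 normc_e2pii divr1 expr1n lerDl.
    by apply: sumr_ge0 => i _; exact: sqr_ge0.
  have : D <= D * d by rewrite ler_peMr.
  lra.
have [Nd|Nd] := leP (N%:R * d) 1.
  have := fejer_sum_ge (leqnn N) Nd; lra.
have dgt0 : 0 < d by rewrite lt_neqAle d0 andbT; apply: contraTneq Nd => <-; rewrite mulr0 ltr10.
(* [P] is the longest length at which the kernel is still near its peak. Then [D <= 2 / d <= 4 P]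
   and [P / 4] bounds the Fejer average from below, whence the constant 16. *)
set P := Num.truncn d^-1.
have /andP[P1 P2] : P%:R <= d^-1 < P.+1%:R by apply: truncn_itv; rewrite invr_ge0.
have PN : (P <= N)%N.
  rewrite -(ler_nat R); apply: le_trans P1 _.
  by rewrite -[d^-1]mul1r ler_pdivrMr // ltW.
have Pd : P%:R * d <= 1 by rewrite -ler_pdivlMr // mul1r.
have P0 : (0 < P)%N by rewrite truncn_gt0 invf_ge1 // ltW.
have := fejer_sum_ge PN Pd.
have : D <= 4 * P%:R.
  have : D <= 2 * d^-1 by rewrite ler_pdivlMr.
  have : P.+1%:R <= 2 * P%:R :> R by rewrite -natrM ler_nat mul2n -addnn -addn1 leq_add2l.
  lra.
lra.
Qed.

End Fejer.

(** * Orthogonality of the exponentials over a unit interval *)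

Section Orthogonality.
Variable R : realType.
Implicit Types x y z : R.
Local Notation mu := (@lebesgue_measure R).

Lemma sin_int (k : int) y : sin (2 * pi * (k%:~R + y)) = sin (2 * pi * y).
Proof.
have H (n : nat) (t : R) : sin (2 * pi * (n%:R + t)) = sin (2 * pi * t).
  have -> : 2 * pi * (n%:R + t) = 2 * pi * t + pi *+ 2 *+ n
    by rewrite -mulrnA -[X in _ = _ + X]mulr_natl natrM; ring.
  exact: (periodicn (@sinD2pi R)).
case: k => n; first exact: H.
by rewrite -[LHS](H n.+1) addrA NegzE mulrNz -pmulrn subrr add0r.
Qed.

Lemma is_derive_sin_affine a b x :
  is_derive x 1 (fun t : R => sin (a * t + b)) (a * cos (a * x + b)).
Proof.
have : is_derive x 1 (fun t : R => a * t + b) a.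
  have := is_deriveD (is_deriveZ a (is_derive_id x (1 : R))) (is_derive_cst b x 1).
  by rewrite addr0 /GRing.scale /= mulr1.
move=> H; have := @is_derive1_comp R (@sin R) (fun t => a * t + b) x _ _ (is_derive_sin _) H.
by rewrite mulrC.
Qed.

Lemma is_derive_continuous (f f' : R -> R) :
  (forall x, is_derive x 1 f (f' x)) -> continuous f.
Proof.
move=> df x; apply/differentiable_continuous/derivable1_diffP.
by have [] := df x.
Qed.

Lemma continuous_cos_affine a b : continuous (fun t : R => cos (a * t + b)).
Proof.
have -> : (fun t : R => cos (a * t + b)) = (fun t => sin (a * t + (b + pi / 2))).
  by apply/funext => t; rewrite addrA sinDpihalf.
apply: (@is_derive_continuous _ (fun x => a * cos (a * x + (b + pi / 2)))) => x.
exact: is_derive_sin_affine.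
Qed.

Lemma integral_cos_affine (k : int) c :
  (\int[mu]_(x in `[0%R, 1%R]) (cos (2 * pi * (k%:~R * x + c)))%:E =
   (if k == 0 then cos (2 * pi * c) else 0)%:E)%E.
Proof.
case: eqP => [->|/eqP k0].
  under eq_integral do rewrite mul0r add0r.
  rewrite integral_cst //= lebesgue_measure_itv /=.
  by rewrite lte_fin ltr01 /= oppr0 adde0 mule1.
have a0 : 2 * pi * k%:~R != 0 :> R.
  by rewrite mulf_neq0 ?intr_eq0 // mulf_neq0 // gt_eqF ?pi_gt0.
set a := 2 * pi * k%:~R in a0.
pose F t := a^-1 * sin (a * t + 2 * pi * c).
have dF x : is_derive x 1 F (cos (2 * pi * (k%:~R * x + c))).
  have := is_deriveZ a^-1 (is_derive_sin_affine a (2 * pi * c) x).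
  by rewrite /GRing.scale /= mulrA mulVf // mul1r [2 * pi * (_ + _)]mulrDr mulrA.
have cF : continuous F := is_derive_continuous dF.
rewrite (@continuous_FTC2 _ _ F) //.
- have -> : F 1 = F 0.
    rewrite /F mulr1 mulr0 add0r.
    by rewrite -mulrDr sin_int.
  by rewrite subee.
- apply: continuous_subspaceT => x.
  have -> : (fun t => cos (2 * pi * (k%:~R * t + c))) = (fun t => cos (a * t + 2 * pi * c)).
    by apply/funext => t; rewrite mulrDr mulrA.
  exact: continuous_cos_affine.
- split; first by move=> x _; have [] := dF x.
  + by apply: cvg_at_right_filter; exact: cF.
  + by apply: cvg_at_left_filter; exact: cF.
- move=> x _; rewrite derive1E; exact: (@derive_val _ _ _ _ _ _ _ (dF x)).
Qed.

Lemma integrable_cos_affine (k : int) c :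
  mu.-integrable `[0, 1]%classic (EFin \o (fun x => cos (2 * pi * (k%:~R * x + c)))).
Proof.
apply: continuous_compact_integrable; first exact: segment_compact.
apply: continuous_subspaceT => x.
have -> : (fun t => cos (2 * pi * (k%:~R * t + c))) =
    (fun t => cos ((2 * pi * k%:~R) * t + 2 * pi * c)).
  by apply/funext => t; rewrite mulrDr mulrA.
exact: continuous_cos_affine.
Qed.

(** Only pairs of equal frequency survive. The phases [t] are kept: with [t = 0] the right side
    counts coincidences, and in the [y]-mean they carry the dependence on [x]. *)
Lemma integral_expsum_sqr (I : finType) (k : I -> int) (t : I -> R) :
  (\int[mu]_(x in `[0%R, 1%R])
     (normc (\sum_i e2pii ((k i)%:~R * x + t i)) ^+ 2)%:E =
   (\sum_i \sum_(j | k i == k j) cos (2 * pi * (t i - t j)))%:E)%E.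
Proof.
under eq_integral => x _.
  rewrite normc_expsum_sqr pair_big /= -sumEFin.
  under eq_bigr => ij _.
    have -> : (k ij.1)%:~R * x + t ij.1 - ((k ij.2)%:~R * x + t ij.2) =
      (k ij.1 - k ij.2)%:~R * x + (t ij.1 - t ij.2) by rewrite intrB; ring.
    over.
  over.
rewrite integral_sum //=; last by move=> ij; exact: integrable_cos_affine.
under eq_bigr do rewrite integral_cos_affine subr_eq0.
rewrite sumEFin pair_big_dep /=; congr (_%:E).
by rewrite [RHS]big_mkcond.
Qed.

End Orthogonality.

(** * Weyl differencing and the mean over the linear coefficient *)

Section Differencing.
Variable R : realType.
Implicit Types x y : R.
Local Notation mu := (@lebesgue_measure R).

(** The index [n < N] stands for the integer [n + 1], so that the sum over ordinals runs from 1 to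
    [N]. *)
Definition quad_phase x y (n : nat) : R := x * n.+1%:R ^+ 2 + y * n.+1%:R.

Definition quad_sum N x y : R := normc (\sum_(n < N) e2pii (quad_phase x y n)).

(* Differencing with shift [h] eliminates the linear coefficient. *)
Definition diff_sum N x h : R := dirichlet (N - h) (2 * h%:R * x).

Definition quad_corr x y (n m : nat) : R :=
  cos (2 * pi * (quad_phase x y n - quad_phase x y m)).

Lemma quad_corrC x y n m : quad_corr x y n m = quad_corr x y m n.
Proof. by rewrite /quad_corr -cosN -mulrN opprB. Qed.

Lemma diff_sum_ge0 N x h : 0 <= diff_sum N x h.
Proof. exact: dirichlet_ge0. Qed.

(** For [n = m + h] the phase difference is [m (2 h x)] plus a term free of [m]. That term contains
    all of [y] and is removed by [cos_sum_le]; the range left is [m < N - h]. *)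
Lemma quad_corr_shift_le N x y h :
  `|\sum_(m < N) \sum_(n < N | (n == m + h :> nat)%N) quad_corr x y n m| <=
  diff_sum N x h.
Proof.
under eq_bigr do rewrite (big_ord1_eq _ (fun n => quad_corr x y n _)).
rewrite -big_mkcond /=.
have -> : \sum_(m < N | (m + h < N)%N) quad_corr x y (m + h) m =
    \sum_(m < N - h) quad_corr x y (m + h) m.
  rewrite (big_ord_widen_cond N xpredT (fun m => quad_corr x y (m + h) m)) ?leq_subr //.
  by apply: eq_bigl => m; rewrite /= ltn_subRL addnC.
rewrite /diff_sum /dirichlet.
apply: le_trans; last exact: (cos_sum_le _ _ (h%:R ^+ 2 * x + 2 * h%:R * x + y * h%:R)).
rewrite le_eqVlt; apply/orP; left; apply/eqP; congr (`| _ |); apply: eq_bigr => m _.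
rewrite /quad_corr /quad_phase; congr (cos (_ * _)).
rewrite -addSn natrD -[m.+1%:R]natr1; ring.
Qed.

(** The correlation is symmetric, so only the distance of [a] and [b] matters; it is written with
    truncated subtractions, one of which is 0. *)
Lemma quad_corr_le N x y a b :
  `|\sum_(n < N) \sum_(m < N | (n + a == m + b)%N) quad_corr x y n m| <=
  diff_sum N x ((a - b) + (b - a)).
Proof.
have [ab|ba] := leqP a b.
  have -> : (a - b + (b - a) = b - a)%N by lia.
  rewrite (exchange_big_dep xpredT) //=.
  apply: le_trans (quad_corr_shift_le N x y (b - a)).
  rewrite le_eqVlt; apply/orP; left; apply/eqP; congr (`| _ |); apply: eq_bigr => m _.
  by apply: eq_bigl => n; lia.
have -> : (a - b + (b - a) = a - b)%N by lia.
apply: le_trans (quad_corr_shift_le N x y (a - b)).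
rewrite le_eqVlt; apply/orP; left; apply/eqP; congr (`| _ |); apply: eq_bigr => n _.
by apply: eq_big => [m|m _]; [lia | exact: quad_corrC].
Qed.

(** The pairs in the expanded square are grouped by their difference, each [h > 0] arising with both
    signs. *)
Lemma quad_sum_sqr_le N x y :
  quad_sum N x y ^+ 2 <= 2 * \sum_(h < N) diff_sum N x h.
Proof.
rewrite /quad_sum normc_expsum_sqr.
(* Both sums on the right contain the diagonal [h = 0], so its [N] unit terms are added once more on
   the left. *)
have E : \sum_(i < N) \sum_(j < N) quad_corr x y i j + N%:R =
    \sum_(h < N) \sum_(n < N) \sum_(m < N | (n + 0 == m + h)%N) quad_corr x y n m +
    \sum_(h < N) \sum_(n < N) \sum_(m < N | (n + h == m + 0)%N) quad_corr x y n m.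
  have -> : N%:R = \sum_(i < N) \sum_(j < N | j == i) quad_corr x y i j.
    under eq_bigr do rewrite big_pred1_eq /quad_corr subrr mulr0 cos0.
    by rewrite sumr_const card_ord.
  rewrite [X in _ = X + _]exchange_big [X in _ = _ + X]exchange_big -!big_split /=.
  apply: eq_bigr => i _.
  rewrite (exchange_big_dep xpredT) //= [X in _ = _ + X](exchange_big_dep xpredT) //=.
  rewrite [X in _ + X = _]big_mkcond -!big_split /=; apply: eq_bigr => j _.
  have S n m : \sum_(h < N | (m + h)%N == n) quad_corr x y i j =
     if (m <= n < N + m)%N then quad_corr x y i j else 0.
    have [mn|nm] := leqP m n.
      rewrite (eq_bigl (fun h : 'I_N => h == n - m :> nat)%N); last by move=> h; lia.
      by rewrite (big_ord1_eq _ (fun=> quad_corr x y i j)) /= ltn_subLR // addnC.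
    by rewrite big_pred0 // => h; lia.
  have iN := ltn_ord i; have jN := ltn_ord j.
  rewrite (eq_bigl (fun h : 'I_N => j + h == i)%N); last by move=> h; lia.
  rewrite [X in _ = _ + X](eq_bigl (fun h : 'I_N => i + h == j)%N); last by move=> h; lia.
  rewrite !S; have [ij|ij|/val_inj ->] := ltngtP (i : nat) j.
  - rewrite (_ : j == i = false); last by apply/eqP => ji; move: ij; rewrite ji ltnn.
    by rewrite addr0 add0r ifT //; lia.
  - rewrite (_ : j == i = false); last by apply/eqP => ji; move: ij; rewrite ji ltnn.
    by rewrite !addr0 ifT //; lia.
  - by rewrite eqxx ifT //; lia.
have : \sum_(i < N) \sum_(j < N) quad_corr x y i j + N%:R <=
    \sum_(h < N) diff_sum N x h + \sum_(h < N) diff_sum N x h.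
  rewrite E; apply: lerD; apply: ler_sum => h _.
    by have := quad_corr_le N x y 0 h; rewrite sub0n add0n subn0; apply: le_trans; exact: ler_norm.
  by have := quad_corr_le N x y h 0; rewrite sub0n addn0 subn0; apply: le_trans; exact: ler_norm.
have := ler0n R N; rewrite /quad_corr; lra.
Qed.

(** A given distance [h] from [a] is attained at most at [a - h] and [a + h]. *)
Lemma sum_dist_le K (F : nat -> R) (a : nat) : (forall h, 0 <= F h) -> (a < K)%N ->
  \sum_(b < K) F ((a - b) + (b - a))%N <= 2 * \sum_(h < K) F h.
Proof.
move=> F0 aK.
have -> : \sum_(b < K) F ((a - b) + (b - a))%N =
    \sum_(h < K) \sum_(b < K | (h == (a - b) + (b - a) :> nat)%N) F h.
  rewrite (exchange_big_dep xpredT) //=; apply: eq_bigr => b _.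
  rewrite (big_ord1_eq _ F) ifT //; have := ltn_ord b; lia.
rewrite mulr_sumr; apply: ler_sum => h _.
rewrite big_mkcond /=.
apply: (@le_trans _ _ (\sum_(b < K) ((if (b == a - h :> nat)%N then F h else 0) +
   (if (b == a + h :> nat)%N then F h else 0)))).
  apply: ler_sum => b _; have := F0 h.
  by case: eqP => H1; case: eqP => H2; case: eqP => H3 // Fh; first [lia | lra].
rewrite big_split /= -!big_mkcond !(big_ord1_eq _ (fun=> F h)).
by have := F0 h; case: ifP => _; case: ifP => _ Fh; lra.
Qed.

(** The product is a single exponential sum over pairs [(a, n)] with frequency [a + n + 1] in [y].
    Orthogonality leaves [n + a = m + b], a correlation of shift at most [K - 1], and each of the
    [K] values of [a] meets every distance at most twice. *)
Lemma integral_dirichlet_quad_sum_le K N x :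
  (\int[mu]_(y in `[0%R, 1%R]) ((dirichlet K y * quad_sum N x y) ^+ 2)%:E <=
   (2 * K%:R * \sum_(h < K) diff_sum N x h)%:E)%E.
Proof.
pose k (an : 'I_K * 'I_N) : int := (an.1 + an.2.+1)%N%:Z.
pose t (an : 'I_K * 'I_N) : R := x * an.2.+1%:R ^+ 2.
under eq_integral => y _.
  rewrite /dirichlet /quad_sum -normcM big_distrlr pair_big /=.
  under eq_bigr => an _.
    rewrite -e2piiD.
    have -> : an.1%:R * y + quad_phase x y an.2 = (k an)%:~R * y + t an.
      by rewrite /k /t /quad_phase -pmulrn natrD; ring.
    over.
  over.
rewrite integral_expsum_sqr lee_fin.
have -> : \sum_i \sum_(j | k i == k j) cos (2 * pi * (t i - t j)) =
   \sum_(a < K) \sum_(b < K) \sum_(n < N) \sum_(m < N | (n + a == m + b)%N) quad_corr x 0 n m.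
  rewrite -(pair_bigA _ (fun a n => \sum_(j | k (a, n) == k j) cos (2 * pi * (t (a, n) - t j)))).
  apply: eq_bigr => a _ /=; rewrite [RHS]exchange_big; apply: eq_bigr => n _.
  rewrite pair_big_dep /=; apply: eq_big => [[b m]|[b m] _].
    by rewrite /k /= eqz_nat; lia.
  by rewrite /quad_corr /quad_phase /t !mul0r !addr0.
have -> : 2 * K%:R * \sum_(h < K) diff_sum N x h = \sum_(a < K) (2 * \sum_(h < K) diff_sum N x h).
  by rewrite sumr_const card_ord -[RHS]mulr_natl; ring.
apply: ler_sum => a _.
apply: le_trans (sum_dist_le (diff_sum_ge0 N x) (ltn_ord a)).
by apply: ler_sum => b _; apply: le_trans (quad_corr_le N x 0 a b); exact: ler_norm.
Qed.

End Differencing.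

(** * Counting solutions of the proportion h m = k l *)

Section Counting.
Local Open Scope nat_scope.

Definition proportions N h k : {set 'I_N * 'I_N} :=
  [set ml : 'I_N * 'I_N | h * ml.1 == k * ml.2].

(** Subtracting two representations of one value gives [h (a - b) = k (d - c)], where both
    differences have the same sign. For either sign, the absolute differences form a proportion that
    determines [(b, d)]; hence the factor 2. *)
Lemma card_linear_fiber N M M' h k (a c : nat) : M <= N -> M' <= N ->
  0 < h -> 0 < k -> a < M -> c < M' ->
  #|[set bd : 'I_M * 'I_M' | h * a + k * c == h * bd.1 + k * bd.2]| <=
  2 * #|proportions N h k|.
Proof.
move=> MN M'N h0 k0 aM cM.
have N0 : 0 < N by lia.
(* [inord] takes values in ordinals below a successor. *)
case: N MN M'N N0 => // n MN M'N _.
set S := [set _ | _].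
rewrite -(cardsID [set bd : 'I_M * 'I_M' | bd.1 <= a] S) mul2n -addnn.
apply: leq_add.
  pose f (bd : 'I_M * 'I_M') : 'I_n.+1 * 'I_n.+1 := (inord (a - bd.1), inord (bd.2 - c)).
  rewrite -(@card_in_imset _ _ f).
    apply/subset_leq_card/fintype.subsetP => _ /imsetP[[b d] + ->].
    rewrite !inE /= => /andP[/eqP E ba].
    have bM := ltn_ord b; have dM := ltn_ord d.
    rewrite !inordK; [|lia|lia].
    have cd : c <= d by rewrite -(leq_pmul2l k0); nia.
    rewrite !mulnBr; apply/eqP.
    by have := leq_mul (leqnn h) ba; have := leq_mul (leqnn k) cd; lia.
  move=> [b d] [b' d']; rewrite !inE /= => /andP[/eqP E ba] /andP[/eqP E' b'a] [].
  have bM := ltn_ord b; have dM := ltn_ord d.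
  have b'M := ltn_ord b'; have d'M := ltn_ord d'.
  have cd : c <= d by rewrite -(leq_pmul2l k0); nia.
  have cd' : c <= d' by rewrite -(leq_pmul2l k0); nia.
  move=> /(congr1 val) /=; rewrite !inordK; [|lia|lia] => e1.
  move=> /(congr1 val) /=; rewrite !inordK; [|lia|lia] => e2.
  by congr (_, _); apply/val_inj => /=; lia.
pose f (bd : 'I_M * 'I_M') : 'I_n.+1 * 'I_n.+1 := (inord (bd.1 - a), inord (c - bd.2)).
rewrite -(@card_in_imset _ _ f).
  apply/subset_leq_card/fintype.subsetP => _ /imsetP[[b d] + ->].
  rewrite !inE /= -ltnNge => /andP[ba /eqP E].
  have bM := ltn_ord b; have dM := ltn_ord d.
  rewrite !inordK; [|lia|lia].
  have cd : d <= c by rewrite -(leq_pmul2l k0); nia.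
  rewrite !mulnBr; apply/eqP.
  by have := leq_mul (leqnn h) (ltnW ba); have := leq_mul (leqnn k) cd; lia.
move=> [b d] [b' d']; rewrite !inE /= -!ltnNge => /andP[ba /eqP E] /andP[b'a /eqP E'] [].
have bM := ltn_ord b; have dM := ltn_ord d.
have b'M := ltn_ord b'; have d'M := ltn_ord d'.
have cd : d <= c by rewrite -(leq_pmul2l k0); nia.
have cd' : d' <= c by rewrite -(leq_pmul2l k0); nia.
move=> /(congr1 val) /=; rewrite !inordK; [|lia|lia] => e1.
move=> /(congr1 val) /=; rewrite !inordK; [|lia|lia] => e2.
by congr (_, _); apply/val_inj => /=; lia.
Qed.

Definition hyperbola N X : {set 'I_N * 'I_N} :=
  [set y : 'I_N * 'I_N | [&& 0 < y.1, 0 < y.2 & y.1 * y.2 < X]].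

(** The solution is sent to [((d, k'), (h', t))] in the parametrisation [h = d h'], [k = d k'],
    [m = k' t], [l = h' t]. The conditions [d k' = k < K] and [h' t = l < N] place the two pairs
    under hyperbolas, and the four parameters recover the solution. *)
Lemma card_positive_proportions N K :
  #|[set x : ('I_N * 'I_N) * ('I_N * 'I_N) |
     [&& 0 < x.1.1, 0 < x.1.2 < K, 0 < x.2.1 & x.1.1 * x.2.1 == x.1.2 * x.2.2]]|
  <= #|hyperbola N K| * #|hyperbola N N|.
Proof.
case: N => [|n]; first by rewrite (eq_card0 (A := _)) // => -[[[]]].
rewrite -cardsX.
pose f (x : ('I_n.+1 * 'I_n.+1) * ('I_n.+1 * 'I_n.+1)) :
    ('I_n.+1 * 'I_n.+1) * ('I_n.+1 * 'I_n.+1) :=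
  let d := gcdn x.1.1 x.1.2 in
  ((inord d, inord (x.1.2 %/ d)), (inord (x.1.1 %/ d), inord (x.2.2 %/ (x.1.1 %/ d)))).
(* With [d] the gcd, [h'] and [k'] are coprime and [h' m = k' l], so [h'] divides [l]; [t] is the
   quotient. *)
have key (h k m l : nat) : 0 < h -> 0 < k -> 0 < m -> h * m = k * l ->
    exists d h' k' t, [/\ gcdn h k = d, [/\ 0 < d, 0 < h', 0 < k' & 0 < t],
      h = d * h', k = d * k' & m = k' * t /\ l = h' * t].
  move=> h0 k0 m0 E; have d0 : 0 < gcdn h k by rewrite gcdn_gt0 h0.
  have /dvdnP[h' Eh] := dvdn_gcdl h k; have /dvdnP[k' Ek] := dvdn_gcdr h k.
  have h'0 : 0 < h' by case: h' Eh => // Eh; move: h0; rewrite Eh.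
  have k'0 : 0 < k' by case: k' Ek => // Ek; move: k0; rewrite Ek.
  have co : coprime h' k'.
    rewrite /coprime -(eqn_pmul2l d0) muln1 muln_gcdr.
    by rewrite [_ * h']mulnC -Eh [_ * k']mulnC -Ek.
  have E' : h' * m = k' * l.
    apply/eqP; rewrite -(eqn_pmul2l d0) !mulnA [_ * h']mulnC -Eh [_ * k']mulnC -Ek.
    by rewrite E.
  have /dvdnP[t Et] : h' %| l by rewrite -(Gauss_dvdr _ co) -E' dvdn_mulr.
  exists (gcdn h k), h', k', t; split=> //; try by rewrite mulnC.
    split=> //; case: t Et => // Et; move: E'; rewrite Et muln0 => /eqP.
    by rewrite muln_eq0; lia.
  split; last by rewrite mulnC.
  by apply/eqP; rewrite -(eqn_pmul2l h'0) E' Et; apply/eqP; nia.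
rewrite -(@card_in_imset _ _ f).
  apply/subset_leq_card/fintype.subsetP => _ /imsetP[[[h k] [m l]] + ->].
  rewrite !inE /= => /and4P[h0 /andP[k0 kK] m0 /eqP E].
  have [d [h' [k' [t [Ed [d0 h'0 k'0 t0] Eh Ek [Em El]]]]]] := key _ _ _ _ h0 k0 m0 E.
  have hn := ltn_ord h; have kn := ltn_ord k; have ln := ltn_ord l.
  rewrite /f /= Ed Eh Ek El !mulKn //.
  have ? : d <= d * h' by rewrite leq_pmulr.
  have ? : h' <= d * h' by rewrite leq_pmull.
  have ? : k' <= d * k' by rewrite leq_pmull.
  have ? : t <= h' * t by rewrite leq_pmull.
  by rewrite !inordK ?d0 ?h'0 ?k'0 ?t0 -?Ek -?El ?kK /=; lia.
move=> [[h1 k1] [m1 l1]] [[h2 k2] [m2 l2]].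
rewrite !inE /= => /and4P[h10 /andP[k10 _] m10 /eqP E1] /and4P[h20 /andP[k20 _] m20 /eqP E2].
have [d1 [h1' [k1' [t1 [Ed1 [d10 h1'0 k1'0 t10] Eh1 Ek1 [Em1 El1]]]]]] :=
  key _ _ _ _ h10 k10 m10 E1.
have [d2 [h2' [k2' [t2 [Ed2 [d20 h2'0 k2'0 t20] Eh2 Ek2 [Em2 El2]]]]]] :=
  key _ _ _ _ h20 k20 m20 E2.
have := ltn_ord h1; have := ltn_ord k1; have := ltn_ord l1.
have := ltn_ord h2; have := ltn_ord k2; have := ltn_ord l2.
rewrite /f /= Ed1 Ed2 Eh1 Ek1 El1 Eh2 Ek2 El2 !mulKn //.
have ? : d1 <= d1 * h1' by rewrite leq_pmulr.
have ? : h1' <= d1 * h1' by rewrite leq_pmull.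
have ? : k1' <= d1 * k1' by rewrite leq_pmull.
have ? : t1 <= h1' * t1 by rewrite leq_pmull.
have ? : d2 <= d2 * h2' by rewrite leq_pmulr.
have ? : h2' <= d2 * h2' by rewrite leq_pmull.
have ? : k2' <= d2 * k2' by rewrite leq_pmull.
have ? : t2 <= h2' * t2 by rewrite leq_pmull.
move=> ? ? ? ? ? ? [].
move=> /(congr1 val) /=; rewrite !inordK; [|lia|lia] => e1.
move=> /(congr1 val) /=; rewrite !inordK; [|lia|lia] => e2.
move=> /(congr1 val) /=; rewrite !inordK; [|lia|lia] => e3.
move=> /(congr1 val) /=; rewrite !inordK; [|lia|lia] => e4.
by congr (_, _, (_, _)); apply/val_inj => /=;
  rewrite ?Eh1 ?Eh2 ?Ek1 ?Ek2 ?Em1 ?Em2 ?El1 ?El2 ?e1 ?e2 ?e3 ?e4.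
Qed.

Lemma card_hyperbola N X :
  #|hyperbola N X| <= \sum_(d < N | 0 < d) X %/ d.
Proof.
rewrite -sum1_card.
rewrite (eq_bigl (fun y : 'I_N * 'I_N => (0 < y.1) && ((0 < y.2) && (y.1 * y.2 < X)))); last first.
  by move=> y; rewrite inE.
rewrite -(pair_big_dep (fun d : 'I_N => 0 < d)
  (fun d t : 'I_N => (0 < t) && (d * t < X)) (fun _ _ => 1)) /=.
apply: leq_sum => d d0.
rewrite sum1_card cardE -(size_iota 1 (X %/ d)) -(size_map val).
apply: uniq_leq_size.
  by rewrite map_inj_uniq ?enum_uniq //; exact: val_inj.
move=> _ /mapP[t + ->]; rewrite mem_enum unfold_in mem_iota /= => /andP[t0 dt].
by rewrite t0 add1n ltnS leq_divRL // mulnC ltnW.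
Qed.

End Counting.

(** * Harmonic sums and their growth *)

Section Harmonic.
Variable R : realType.

Definition harmonic_sum (N : nat) : R := \sum_(d < N) d.+1%:R^-1.

Lemma card_hyperbola_le N X : #|hyperbola N X|%:R <= X%:R * harmonic_sum N.
Proof.
have := card_hyperbola N X; rewrite -(ler_nat R) => /le_trans; apply.
rewrite natr_sum /harmonic_sum mulr_sumr.
case: N => [|n]; first by rewrite !big_ord0.
rewrite big_mkcond big_ord_recl /= add0r.
rewrite [leRHS]big_ord_recr /= -[leLHS]addr0; apply: lerD; last first.
  by rewrite divr_ge0.
apply: ler_sum => i _.
by rewrite /bump /= ler_pdivlMr ?ltr0n // -natrM ler_nat add1n leq_trunc_div.
Qed.

Lemma harmonic_sum_ge1 N : (0 < N)%N -> 1 <= harmonic_sum N.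
Proof.
case: N => // n _; rewrite /harmonic_sum big_ord_recl invr1 lerDl.
by apply: sumr_ge0.
Qed.

(** The logarithm bounds the harmonic sum, and [ln (1 + z) <= z] at [1 + z = N ^ d] gives
    [ln N <= N ^ d / d]. *)
Lemma harmonic_sum_le_powR (d : R) N : 0 < d -> (0 < N)%N ->
  harmonic_sum N <= (1 + d^-1) * N%:R `^ d.
Proof.
move=> d0 N0.
have H : harmonic_sum N <= 1 + ln N%:R.
  case: N N0 => // n _; rewrite /harmonic_sum.
  elim: n => [|n IHn]; first by rewrite big_ord1 invr1 ln1 addr0.
  rewrite big_ord_recr /=.
  suff : n.+2%:R^-1 <= ln n.+2%:R - ln n.+1%:R :> R.
    move=> h; apply: le_trans (lerD IHn h) _.
    by rewrite addrA [1 + _ + _]addrAC addrK.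
  rewrite -ln_div ?posrE ?ltr0n //.
  have n2 : n.+2%:R != 0 :> R by rewrite pnatr_eq0.
  have n1 : n.+1%:R != 0 :> R by rewrite pnatr_eq0.
  (* In this form the increment of the logarithm is [- ln (1 - 1 / (n + 2))], to which
     [ln (1 + z) <= z] applies. *)
  have -> : n.+2%:R / n.+1%:R = (1 - n.+2%:R^-1)^-1 :> R.
    rewrite -[LHS]invf_div; congr (_^-1).
    by rewrite -[n.+2%:R]natr1 in n2 *; field.
  rewrite lnV ?posrE ?subr_gt0 ?invf_lt1 ?ltr1n ?ltr0n //.
  rewrite lerNr; apply: le_ln1Dx; rewrite ltrNl opprK invf_lt1 ?ltr1n ?ltr0n //.
have L : ln N%:R <= d^-1 * N%:R `^ d :> R.
  have P : 0 < (N%:R : R) `^ d by apply: powR_gt0; rewrite ltr0n.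
  have := le_ln1Dx (x := (N%:R : R) `^ d - 1).
  rewrite addrCA subrr addr0 ln_powR => h.
  rewrite mulrC ler_pdivlMr // mulrC.
  by apply: le_trans (h _) _; [rewrite ltrBrDl addrN | rewrite gerBl].
have : 1 <= (N%:R : R) `^ d.
  have := @ler_powR R N%:R; rewrite ler1n => /(_ N0 0 d (ltW d0)).
  by rewrite powRr0.
rewrite mulrDl mul1r => P1; apply: le_trans H _; exact: lerD.
Qed.

End Harmonic.

(** * The bilinear mean value of the differenced sums *)

Section Bilinear.
Variable R : realType.
Implicit Types x y : R.
Local Notation mu := (@lebesgue_measure R).

(** The domain is left general because both functions on the line and functions on the plane are
    needed. *)
Lemma measurable_normc_expsum d (T : measurableType d) (I : Type) (r : seq I)
    (t : I -> T -> R) : (forall i, measurable_fun setT (t i)) ->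
  measurable_fun setT (fun w => normc (\sum_(i <- r) e2pii (t i w))).
Proof.
move=> mt.
have -> : (fun w => normc (\sum_(i <- r) e2pii (t i w))) = (@Num.sqrt R) \o
    (fun w => (\sum_(i <- r) cos (2 * pi * t i w)) ^+ 2 +
              (\sum_(i <- r) sin (2 * pi * t i w)) ^+ 2).
  apply/funext => w /=.
  have -> : normc (\sum_(i <- r) e2pii (t i w)) =
      Num.sqrt (complex.Re (\sum_(i <- r) e2pii (t i w)) ^+ 2 +
                complex.Im (\sum_(i <- r) e2pii (t i w)) ^+ 2) by case: (bigop _ _ _).
  by rewrite Re_sum Im_sum.
apply: measurableT_comp.
  by apply: continuous_measurable_fun; exact: sqrt_continuous.
apply: measurable_funD; apply: measurable_funX; apply: measurable_sum => i.
- apply: (measurableT_comp (f := @cos R)).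
    by apply: continuous_measurable_fun; exact: continuous_cos.
  by apply: measurable_funM => //; exact: measurable_cst.
- apply: (measurableT_comp (f := @sin R)).
    by apply: continuous_measurable_fun; exact: continuous_sin.
  by apply: measurable_funM => //; exact: measurable_cst.
Qed.

Lemma measurable_dirichlet M (c : R) : measurable_fun setT (fun x => dirichlet M (c * x)).
Proof.
apply: (@measurable_normc_expsum _ _ _ _ (fun (m : 'I_M) x => m%:R * (c * x))) => m.
by apply: measurable_funM => //; apply: measurable_funM.
Qed.

Lemma measurable_fejer_sum N (c : R) : measurable_fun setT (fun x => fejer_sum N (c * x)).
Proof.
apply: measurable_sum => M; apply: measurable_funX.
by apply: measurable_funM => //; exact: measurable_dirichlet.
Qed.

Lemma measurable_diff_sum N h : measurable_fun setT (fun x => diff_sum N x h).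
Proof. exact: measurable_dirichlet. Qed.

(** The product is an exponential sum with frequencies [2 (h a + k c)]; by [card_linear_fiber] each
    of its [M M'] terms shares its frequency with a bounded number of others. *)
Lemma integral_dirichlet2_le N M M' h k : (M <= N)%N -> (M' <= N)%N -> (0 < h)%N -> (0 < k)%N ->
  (\int[mu]_(x in `[0%R, 1%R])
    ((dirichlet M (2 * h%:R * x) * dirichlet M' (2 * k%:R * x)) ^+ 2)%:E <=
   (M%:R * M'%:R * (2 * #|proportions N h k|%:R))%:E)%E.
Proof.
move=> MN M'N h0 k0.
pose f (ac : 'I_M * 'I_M') : int := (2 * (h * ac.1 + k * ac.2))%N%:Z.
under eq_integral => x _.
  rewrite /dirichlet -normcM big_distrlr pair_big /=.
  under eq_bigr => ac _.
    rewrite -e2piiD.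
    have -> : ac.1%:R * (2 * h%:R * x) + ac.2%:R * (2 * k%:R * x) = (f ac)%:~R * x + 0.
      by rewrite /f -pmulrn natrM natrD !natrM; ring.
    over.
  over.
rewrite (integral_expsum_sqr f (fun=> 0)) lee_fin.
have -> : M%:R * M'%:R * (2 * #|proportions N h k|%:R) =
    \sum_(ac : 'I_M * 'I_M') (2 * #|proportions N h k|%:R) :> R.
  by rewrite sumr_const card_prod !card_ord -[RHS]mulr_natl natrM.
apply: ler_sum => -[a c] _.
under eq_bigr do rewrite subrr mulr0 cos0.
rewrite sumr_const -natrM ler_nat.
apply: leq_trans (card_linear_fiber MN M'N h0 k0 (ltn_ord a) (ltn_ord c)).
apply: subset_leq_card; apply/fintype.subsetP => -[b d].
by rewrite inE unfold_in /= => /eqnP/eqP; rewrite eqn_pmul2l.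
Qed.

(** The mean value of the kernels of lengths [M] and [M'] grows like [M M'] while the weight is
    [1 / (M M')^2]; the remaining reciprocals sum to the square of the harmonic sum. *)
Lemma integral_fejer_sum2_le N h k : (0 < h)%N -> (0 < k)%N ->
  (\int[mu]_(x in `[0%R, 1%R])
    (fejer_sum N (2 * h%:R * x) * fejer_sum N (2 * k%:R * x))%:E <=
   (2 * harmonic_sum R N ^+ 2 * #|proportions N h k|%:R)%:E)%E.
Proof.
move=> h0 k0.
pose D (MM : 'I_N * 'I_N) x := (dirichlet MM.1.+1 (2 * h%:R * x) *
  dirichlet MM.2.+1 (2 * k%:R * x)) ^+ 2.
pose w (MM : 'I_N * 'I_N) : R := (MM.1.+1%:R^-1 * MM.2.+1%:R^-1) ^+ 2.
have mD MM : measurable_fun `[(0 : R), 1]%classic (EFin \o D MM).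
  apply/measurable_EFinP; apply: measurable_funTS; apply: measurable_funX.
  by apply: measurable_funM; exact: measurable_dirichlet.
have D0 MM x : (0 <= (D MM x)%:E)%E by rewrite lee_fin sqr_ge0.
under eq_integral => x _.
  rewrite /fejer_sum big_distrlr pair_big /=.
  have -> : \sum_(p : 'I_N * 'I_N) (dirichlet p.1.+1 (2 * h%:R * x) / p.1.+1%:R) ^+ 2 *
      (dirichlet p.2.+1 (2 * k%:R * x) / p.2.+1%:R) ^+ 2 = \sum_p w p * D p x.
    by apply: eq_bigr => p _; rewrite /w /D !exprMn; ring.
  rewrite -sumEFin.
  under eq_bigr do rewrite EFinM.
  over.
rewrite /= ge0_integral_sum //; last 2 first.
- by move=> p; apply: measurable_funeM; exact: mD.
- by move=> p x _; rewrite mule_ge0 // lee_fin sqr_ge0.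
apply: (@le_trans _ _ (\sum_(p : 'I_N * 'I_N)
    (w p * (p.1.+1%:R * p.2.+1%:R * (2 * #|proportions N h k|%:R)))%:E)%E).
  apply: lee_sum => p _.
  rewrite ge0_integralZl_EFin //; [|exact: (mD p)|by rewrite sqr_ge0].
  rewrite [leRHS]EFinM; apply: lee_wpmul2l; first by rewrite lee_fin sqr_ge0.
  exact: integral_dirichlet2_le.
rewrite sumEFin lee_fin.
have -> : harmonic_sum R N ^+ 2 = \sum_(p : 'I_N * 'I_N) p.1.+1%:R^-1 * p.2.+1%:R^-1.
  by rewrite expr2 big_distrlr pair_big.
rewrite mulr_sumr mulr_suml le_eqVlt; apply/orP; left; apply/eqP; apply: eq_bigr => p _.
rewrite /w; field.
by rewrite nat1r nat1r !pnatr_eq0.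
Qed.

(** This is [S] for [K = N] and [T] for the shorter length. The shift 0 is left out, as its
    contribution is the constant [N]. *)
Definition offdiag_sum N K x : R := \sum_(h < N | (0 < h < K)%N) diff_sum N x h.

Lemma offdiag_sum_ge0 N K x : 0 <= offdiag_sum N K x.
Proof. by apply: sumr_ge0 => h _; exact: diff_sum_ge0. Qed.

Lemma measurable_offdiag_sum N K : measurable_fun setT (offdiag_sum N K).
Proof.
rewrite /offdiag_sum; under eq_fun do rewrite -big_filter.
by apply: measurable_sum => h; exact: measurable_diff_sum.
Qed.

Lemma sum_diff_sumE N K x : (0 < K <= N)%N ->
  \sum_(h < K) diff_sum N x h = N%:R + offdiag_sum N K x.
Proof.
case/andP; case: N => [|n]; first by case: K.
case: K => // m _ mn.
rewrite (big_ord_widen _ (diff_sum n.+1 x) mn) (bigD1 ord0) //=; congr (_ + _).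
  rewrite /diff_sum subn0 /dirichlet.
  under eq_bigr do rewrite mulr0 mul0r mulr0 /e2pii mulr0 cos0 sin0.
  have -> : \sum_(i < n.+1) (1 +i* 0 : R[i])%C = ((n.+1%:R : R)%:C)%C.
    by rewrite sumr_const card_ord rmorph_nat.
  by rewrite /= expr0n /= addr0 sqrtr_sqr ger0_norm.
by apply: eq_bigl => h; rewrite lt0n andbC.
Qed.

Lemma offdiag_sum_le_sqr N x : offdiag_sum N N x <= N%:R ^+ 2.
Proof.
apply: (@le_trans _ _ (\sum_(h < N) N%:R)); last first.
  by rewrite sumr_const card_ord -[leLHS]mulr_natl.
rewrite /offdiag_sum big_mkcond; apply: ler_sum => h _.
case: ifP => _ //; apply: le_trans (dirichlet_le _ _) _.
by rewrite ler_nat leq_subr.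
Qed.

Lemma offdiag_sum_mono N K x : offdiag_sum N K x <= offdiag_sum N N x.
Proof.
rewrite /offdiag_sum big_mkcond [leRHS]big_mkcond; apply: ler_sum => h _.
by rewrite ltn_ord andbT; case: (0 < h)%N => //=; case: ifP => _ //; exact: diff_sum_ge0.
Qed.

(** A solution with [m = 0] has [l = 0], which accounts for one solution per pair [(h, k)] and at
    most [N K] in all. The others are counted under the two hyperbolas. *)
Lemma sum_card_proportions N K : (0 < N)%N ->
  \sum_(hk : 'I_N * 'I_N | (0 < hk.1)%N && (0 < hk.2 < K)%N) #|proportions N hk.1 hk.2|%:R <=
  2 * N%:R * K%:R * harmonic_sum R N ^+ 2.
Proof.
move=> N0.
pose P := [set x : ('I_N * 'I_N) * ('I_N * 'I_N) |
  [&& 0 < x.1.1, 0 < x.1.2 < K, 0 < x.2.1 & x.1.1 * x.2.1 == x.1.2 * x.2.2]]%N.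
have H1 : 1 <= harmonic_sum R N by exact: harmonic_sum_ge1.
have cardP : #|P|%:R <= K%:R * harmonic_sum R N * (N%:R * harmonic_sum R N).
  apply: (@le_trans _ _ (#|hyperbola N K| * #|hyperbola N N|)%N%:R).
    by rewrite ler_nat; exact: card_positive_proportions.
  by rewrite natrM; apply: ler_pM => //; exact: card_hyperbola_le.
have split_card : (\sum_(hk : 'I_N * 'I_N | (0 < hk.1)%N && (0 < hk.2 < K)%N)
    #|proportions N hk.1 hk.2| <= N * K + #|P|)%N.
  apply: (@leq_trans (\sum_(hk : 'I_N * 'I_N | (0 < hk.1)%N && (0 < hk.2 < K)%N)
     (1 + \sum_(ml : 'I_N * 'I_N | (0 < ml.1) && (hk.1 * ml.1 == hk.2 * ml.2)) 1))%N).
    apply: leq_sum => hk /andP[h0 /andP[k0 _]].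
    rewrite -sum1_card (bigID (fun ml : 'I_N * 'I_N => 0 < ml.1)%N) /= addnC.
    apply: leq_add.
      rewrite sum1_card; apply: (@leq_trans #|[set (Ordinal N0, Ordinal N0)]|);
        last by rewrite cards1.
      apply: subset_leq_card; apply/fintype.subsetP => -[m l].
      rewrite unfold_in /= !inE /= -eqn0Ngt => /andP[/eqP E m0].
      have m0' : m = Ordinal N0 by apply/val_inj/eqP.
      rewrite m0' /= xpair_eqE eqxx /= -val_eqE /=.
      by move: E; rewrite m0' muln0 => /esym/eqP; rewrite muln_eq0; lia.
    rewrite leq_eqVlt; apply/orP; left; apply/eqP; apply: eq_bigl => ml.
    by rewrite inE andbC.
  rewrite big_split /=; apply: leq_add.
    rewrite sum1_card; apply: (@leq_trans #|[set: 'I_N * 'I_K]|); last first.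
      by rewrite cardsT card_prod !card_ord.
    case: K @P cardP => [|K'] P cardP.
      by rewrite eq_card0 // => -[h k]; rewrite unfold_in /= ltn0 !andbF.
    pose f (hk : 'I_N * 'I_N) : 'I_N * 'I_K'.+1 := (hk.1, inord hk.2).
    rewrite -(@card_in_imset _ _ f); first by apply: subset_leq_card; rewrite finset.subsetT.
    move=> [h k] [h' k']; rewrite !unfold_in /=.
    move=> /andP[_ /andP[_ kK]] /andP[_ /andP[_ kK']] [-> /(congr1 val)] /=.
    by rewrite !inordK // => /val_inj ->.
  rewrite pair_big_dep /= sum1_card; apply: subset_leq_card; apply/fintype.subsetP => x.
  rewrite unfold_in inE /=; lia.
rewrite -natr_sum; apply: (@le_trans _ _ (N * K + #|P|)%N%:R); first by rewrite ler_nat.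
rewrite natrD natrM.
have : N%:R * K%:R <= N%:R * K%:R * harmonic_sum R N ^+ 2 by rewrite ler_peMr ?mulr_ge0 ?exprn_ege1.
have -> : 2 * N%:R * K%:R * harmonic_sum R N ^+ 2 = N%:R * K%:R * harmonic_sum R N ^+ 2 +
  K%:R * harmonic_sum R N * (N%:R * harmonic_sum R N) by ring.
by move=> h; exact: lerD.
Qed.

(** Two harmonic factors come from the Fejer averages and two from the hyperbolas. The constant is
    [16 * 16] from the pointwise domination, times 2 from [integral_fejer_sum2_le], times 2 from
    [sum_card_proportions]. *)
Lemma integral_offdiag_sum2_le N K : (0 < N)%N ->
  (\int[mu]_(x in `[0%R, 1%R]) (offdiag_sum N N x * offdiag_sum N K x)%:E <=
   (1024 * N%:R * K%:R * harmonic_sum R N ^+ 4)%:E)%E.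
Proof.
move=> N0.
(* An opaque name keeps unification from unfolding the numeral. *)
have [a aE] : exists a : R, a = 16 * 16 by exists (16 * 16).
have a0 : 0 <= a by rewrite aE; apply: mulr_ge0; exact: ler0n.
pose Q (hk : 'I_N * 'I_N) := (0 < hk.1)%N && (0 < hk.2 < K)%N.
pose G (hk : 'I_N * 'I_N) x := fejer_sum N (2 * hk.1%:R * x) * fejer_sum N (2 * hk.2%:R * x).
have G0 hk x : 0 <= G hk x by rewrite mulr_ge0 ?fejer_sum_ge0.
have mG hk : measurable_fun setT (G hk).
  by apply: measurable_funM; exact: measurable_fejer_sum.
have mS : measurable_fun setT (fun x => \sum_(hk | Q hk) G hk x).
  by under eq_fun do rewrite -big_filter; exact: measurable_sum.
apply: (@le_trans _ _ (\int[mu]_(x in `[0%R, 1%R]) (a%:E * (\sum_(hk | Q hk) G hk x)%:E)%E)%E).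
  apply: ge0_le_integral => //=.
  - by move=> x _; rewrite lee_fin mulr_ge0 ?offdiag_sum_ge0.
  - apply/measurable_EFinP; apply: measurable_funTS.
    by apply: measurable_funM; exact: measurable_offdiag_sum.
  - apply: measurable_funeM; apply/measurable_EFinP.
    exact: measurable_funTS.
  - move=> x _; rewrite -EFinM lee_fin /offdiag_sum big_distrlr pair_big /= mulr_sumr.
    rewrite [leRHS](eq_bigl (fun p : 'I_N * 'I_N => (0 < p.1 < N)%N && (0 < p.2 < K)%N)).
      apply: ler_sum => p _.
      rewrite aE /G mulrACA; apply: ler_pM; rewrite ?diff_sum_ge0 //;
      by apply: dirichlet_le_fejer_sum; rewrite leq_subr.
    by move=> p; rewrite /Q ltn_ord andbT.
rewrite ge0_integralZl_EFin //=; last 2 first.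
- by move=> x _; rewrite lee_fin; apply: sumr_ge0 => hk _; exact: G0.
- by apply/measurable_EFinP; exact: measurable_funTS.
under eq_integral do rewrite -big_filter -sumEFin.
rewrite ge0_integral_sum //; last 2 first.
- by move=> hk; apply/measurable_EFinP; apply: measurable_funTS; exact: mG.
- by move=> hk x _; rewrite lee_fin.
rewrite big_filter.
apply: (@le_trans _ _ (a%:E * \sum_(hk | Q hk)
    (2 * harmonic_sum R N ^+ 2 * #|proportions N hk.1 hk.2|%:R)%:E)%E).
  apply: lee_wpmul2l; rewrite ?lee_fin //; apply: lee_sum => hk /andP[h0 /andP[k0 _]].
  exact: integral_fejer_sum2_le.
rewrite sumEFin -EFinM lee_fin -mulr_sumr.
have c0 : 0 <= a * (2 * harmonic_sum R N ^+ 2).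
  by apply: mulr_ge0 => //; apply: mulr_ge0 => //; exact: sqr_ge0.
rewrite mulrA; apply: le_trans (ler_wpM2l c0 (sum_card_proportions K N0)) _.
have -> : a * (2 * harmonic_sum R N ^+ 2) * (2 * N%:R * K%:R * harmonic_sum R N ^+ 2) =
  1024 * N%:R * K%:R * harmonic_sum R N ^+ 4 by rewrite aE; ring.
exact: lexx.
Qed.

End Bilinear.

(** * Reduction to the critical exponent and the integral over the short interval *)

Section MeanValue.
Variable R : realType.
Implicit Types x y u p q : R.
Local Notation mu := (@lebesgue_measure R).

Lemma normc_weyl_sum2 x y N : normc (weyl_sum2 (x, y) N) = quad_sum N x y.
Proof.
rewrite /weyl_sum2 /weyl_sum /quad_sum big_add1 big_mkord; congr normc.
apply: eq_bigr => n _; congr e2pii.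
by rewrite big_ord_recl big_ord1 /= /tnth /= /quad_phase expr1.
Qed.

Lemma quad_sum_ge0 N x y : 0 <= quad_sum N x y.
Proof. exact: normc_ge0. Qed.

Lemma quad_sum_le N x y : quad_sum N x y <= N%:R.
Proof.
apply: le_trans (normc_sum _ _ _) _.
under eq_bigr do rewrite normc_e2pii.
by rewrite sumr_const card_ord.
Qed.

Lemma measurable_quad_sum N :
  measurable_fun setT (fun w : R * R => quad_sum N w.1 w.2).
Proof.
apply: (@measurable_normc_expsum _ _ _ _ _ (fun (n : 'I_N) (w : R * R) =>
  quad_phase w.1 w.2 n)) => n.
by apply: measurable_funD; apply: measurable_funM.
Qed.

Lemma measurable_quad_sum_r N x : measurable_fun setT (quad_sum N x).
Proof.
apply: (@measurable_normc_expsum _ _ _ _ _ (fun (n : 'I_N) y => quad_phase x y n)) => n.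
by apply: measurable_funD => //; apply: measurable_funM.
Qed.

Lemma integral_setX (A B : set R) (f : R * R -> \bar R) :
  measurable A -> measurable B -> measurable_fun setT f ->
  (forall w, (0 <= f w)%E) ->
  (\int[mu \x mu]_(w in A `*` B) f w =
   \int[mu]_(x in A) \int[mu]_(y in B) f (x, y))%E.
Proof.
move=> mA mB mf f0; have mAB := measurableX mA mB.
rewrite integral_mkcond fubini_tonelli1; last 2 first.
- by apply/(measurable_restrictT _ mAB); exact: measurable_funTS.
- by move=> w; apply: erestrict_ge0.
rewrite [RHS]integral_mkcond; apply: eq_integral => x _.
rewrite /fubini_F patchE; case: ifPn => xA.
  rewrite [RHS]integral_mkcond; apply: eq_integral => y _.
  by rewrite !patchE in_setX xA.
by apply: integral0_eq => y _; rewrite patchE in_setX (negbTE xA).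
Qed.

(** Below [sqrt n] the first term suffices. Above it, [f ^ (p - q)] is largest at [f = n] when
    [p >= q] and at [f = sqrt n] when [p < q]. *)
Lemma powR_critical (p q n f : R) : 0 < p -> 1 <= n -> 0 <= f -> f <= n ->
  f `^ p <= n `^ (p / 2) + (n `^ (p - q) + n `^ ((p - q) / 2)) * f `^ q.
Proof.
move=> p0 n1 f0 fn.
have n0 : 0 < n by lra.
have [fs|fs] := leP f (n `^ 2^-1).
  apply: (@le_trans _ _ (n `^ (p / 2))).
    rewrite [p / 2]mulrC powRrM; apply: ge0_ler_powR; rewrite ?nnegrE ?powR_ge0 //.
    exact: ltW.
  by rewrite lerDl mulr_ge0 ?addr_ge0 ?powR_ge0.
have fgt0 : 0 < f by apply: le_lt_trans fs; exact: powR_ge0.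
have -> : f `^ p = f `^ (p - q) * f `^ q.
  by rewrite -powRD ?subrK // (gt_eqF fgt0) implybT.
apply: (@le_trans _ _ ((n `^ (p - q) + n `^ ((p - q) / 2)) * f `^ q)); last first.
  by rewrite lerDr powR_ge0.
apply: ler_wpM2r; first exact: powR_ge0.
have [pq|pq] := leP 0 (p - q).
  apply: (@le_trans _ _ (n `^ (p - q))); last by rewrite lerDl powR_ge0.
  by apply: ge0_ler_powR; rewrite ?nnegrE // ltW.
apply: (@le_trans _ _ (n `^ ((p - q) / 2))); last by rewrite lerDr powR_ge0.
rewrite [(p - q) / 2]mulrC powRrM -[p - q]opprK 2!(powRN _ (- (p - q))).
rewrite lef_pV2 ?posrE ?powR_gt0 //.
apply: ge0_ler_powR; rewrite ?nnegrE ?powR_ge0 //; last exact: ltW.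
by rewrite oppr_ge0 ltW.
Qed.

(** After the power of the sum is split, the four products are brought to the quantities whose means
    are known: constants, [s ^ 2] and [s t]. *)
Lemma offdiag_interpolation u (n s t : R) : 0 < u -> u <= 1 -> 1 <= n ->
  0 <= t -> t <= s -> s <= n ^+ 2 ->
  (2 * (n + s)) `^ (2 - u) * (n + t) <=
  16 * (3 * n `^ (3 - u) + 2 * n `^ (1 - u) * s ^+ 2 + n `^ (2 - 2 * u) * (s * t)).
Proof.
move=> u0 u1 n1 t0 ts sn.
have n0 : 0 < n by lra.
have s0 : 0 <= s by lra.
have q0 : 0 <= 2 - u by lra.
have nD a b : n `^ (a + b) = n `^ a * n `^ b by rewrite powRD // (gt_eqF n0) implybT.
have n2E : n ^+ 2 = n `^ 2 by rewrite -powR_mulrn // ltW.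
(* [2 (n + s)] is at most 4 times the larger of [n] and [s], and [4 ^ (2 - u) <= 16]. *)
have A : (2 * (n + s)) `^ (2 - u) <= 16 * (n `^ (2 - u) + s `^ (2 - u)).
  have B (m : R) : 0 <= m -> (4 * m) `^ (2 - u) <= 16 * m `^ (2 - u).
    move=> m0; rewrite powRM //; apply: ler_wpM2r; first exact: powR_ge0.
    have -> : 16 = 4 `^ 2 :> R by rewrite powR_mulrn //; ring.
    by apply: ler_powR; lra.
  have [sn'|ns] := leP s n.
    apply: (@le_trans _ _ ((4 * n) `^ (2 - u))).
      by apply: ge0_ler_powR; rewrite ?nnegrE //; lra.
    apply: le_trans (B n _) _; first lra.
    by have := powR_ge0 s (2 - u); lra.
  apply: (@le_trans _ _ ((4 * s) `^ (2 - u))).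
    by apply: ge0_ler_powR; rewrite ?nnegrE //; lra.
  apply: le_trans (B s _) _; first lra.
  by have := powR_ge0 n (2 - u); lra.
have S1 : s `^ (2 - u) <= n `^ (2 - u) + n `^ (- u) * s ^+ 2.
  have [sn'|ns] := leP s n.
    apply: (@le_trans _ _ (n `^ (2 - u))).
      by apply: ge0_ler_powR; rewrite ?nnegrE // ltW.
    by rewrite lerDl mulr_ge0 ?powR_ge0 ?sqr_ge0.
  have sgt0 : 0 < s by lra.
  apply: (@le_trans _ _ (n `^ (- u) * s ^+ 2)); last by rewrite lerDr powR_ge0.
  rewrite addrC powRD ?(gt_eqF sgt0) ?implybT // powR_mulrn //.
  apply: ler_wpM2r; first exact: sqr_ge0.
  rewrite !powRN lef_pV2 ?posrE ?powR_gt0 //.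
  by apply: ge0_ler_powR; rewrite ?nnegrE // ltW.
(* One factor [s] is kept to be paired with [t]; the rest is bounded through [s <= n ^ 2]. *)
have S2 : s `^ (2 - u) <= n `^ (2 - 2 * u) * s.
  have -> : 2 - u = (1 - u) + 1 by ring.
  have [->|/eqP sn0] := eqVneq s 0.
    by rewrite mulr0 powR0 // gt_eqF //; lra.
  rewrite powRD ?(introF eqP sn0) ?implybT // powRr1 //.
  apply: ler_wpM2r => //.
  have -> : 2 - 2 * u = 2 * (1 - u) by ring.
  rewrite powRrM -n2E.
  by apply: ge0_ler_powR; rewrite ?nnegrE ?sqr_ge0 //; lra.
have T1 : t <= n + s ^+ 2 / n.
  have [tn|nt] := leP t n.
    by apply: le_trans tn _; rewrite lerDl divr_ge0 ?sqr_ge0 // ltW.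
  apply: (@le_trans _ _ (s ^+ 2 / n)); last by rewrite lerDr ltW.
  rewrite ler_pdivlMr // expr2; apply: ler_pM; lra.
have E1 : n `^ (3 - u) = n `^ (2 - u) * n.
  have -> : 3 - u = (2 - u) + 1 by ring.
  by rewrite nD powRr1 // ltW.
have E2 : n `^ (2 - u) * (s ^+ 2 / n) = n `^ (1 - u) * s ^+ 2.
  have -> : 2 - u = (1 - u) + 1 by ring.
  by rewrite nD powRr1 ?ltW //; field; rewrite gt_eqF.
have E3 : n * (n `^ (- u) * s ^+ 2) = n `^ (1 - u) * s ^+ 2.
  by rewrite nD powRr1 ?ltW // mulrA.
apply: (@le_trans _ _ (16 * (n `^ (2 - u) + s `^ (2 - u)) * (n + t))).
  by apply: ler_wpM2r => //; lra.
rewrite -mulrA; apply: ler_wpM2l => //.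
have P1 : n `^ (2 - u) * t <= n `^ (2 - u) * (n + s ^+ 2 / n).
  by apply: ler_wpM2l => //; exact: powR_ge0.
have P2 : n * s `^ (2 - u) <= n * (n `^ (2 - u) + n `^ (- u) * s ^+ 2).
  by apply: ler_wpM2l => //; exact: ltW.
have P3 : s `^ (2 - u) * t <= n `^ (2 - 2 * u) * s * t by apply: ler_wpM2r.
move: P1 P2 P3; rewrite !mulrDr E2 E3 !mulrDl => P1 P2 P3.
rewrite E1; lra.
Qed.

(** The kernel of length [K] stays near its peak on the whole short interval, so its square can
    majorise the indicator of that interval. *)
Lemma exists_window u N : 0 < u -> u <= 1 -> (2 <= N)%N ->
  exists K : nat, [/\ (0 < K <= N)%N, K%:R <= N%:R `^ u, N%:R `^ u <= 16 * K%:R &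
    forall y, 0 <= y -> y <= N%:R `^ (- u) -> K%:R / 2 <= dirichlet K y].
Proof.
move=> u0 u1 N2.
have N1 : 1 <= N%:R :> R by rewrite ler1n; lia.
have v1 : 1 <= (N%:R : R) `^ u.
  by have := ler_powR N1 (ltW u0); rewrite powRr0.
have vN : (N%:R : R) `^ u <= N%:R by apply: ler1_powR.
set v := (N%:R : R) `^ u in v1 vN *.
have v0 : 0 < v by lra.
have [v16|v16] := leP v 16.
  exists 1%N; rewrite mulr1; split=> //; first by rewrite /=; lia.
  move=> y _ _; rewrite /dirichlet big_ord1 normc_e2pii; lra.
(* Since [2 pi < 8], the length [K = floor (v / 8)] keeps [K * normc (1 - e2pii y)] at most 1. For
   [v > 16] rounding costs at most another factor 2, whence 16. *)
have /andP[K1 K2] : (Num.truncn (v / 8))%:R <= v / 8 < (Num.truncn (v / 8)).+1%:R.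
  by apply: truncn_itv; lra.
set K := Num.truncn _ in K1 K2.
have K2' : v / 8 < K%:R + 1 by rewrite natr1.
exists K; split; [|lra|lra|].
- have K0 : (0 < K)%N by rewrite truncn_gt0; lra.
  rewrite K0 /= -(ler_nat R); lra.
- move=> y y0 yv; apply: dirichlet_ge_half.
  have : normc (1 - e2pii y) <= 8 * v^-1.
    apply: le_trans (normc_1Be2pii y) _; rewrite ger0_norm //.
    apply: ler_pM => //; first by rewrite mulr_ge0 ?pi_ge0.
      by have := @pihalf_lt2 R; lra.
    by rewrite /v -powRN.
  move=> /(ler_wpM2l (ler0n R K)) /le_trans; apply.
  by rewrite mulrA -ler_pdivlMr ?invr_gt0 // invrK mul1r; lra.
Qed.

(** For fixed [x] the integral is bounded by means of [powR_critical] at the exponent [6 - 2 u]. The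
    first term of that bound contributes [n ^ (p / 2)] times the interval length [n ^ (- u)]. *)
Lemma short_integral_le u p N K x : 0 < u -> u <= 1 -> 0 < p -> (2 <= N)%N ->
  (0 < K <= N)%N -> N%:R `^ u <= 16 * K%:R ->
  (forall y, 0 <= y -> y <= N%:R `^ (- u) -> K%:R / 2 <= dirichlet K y) ->
  (\int[mu]_(y in `[0%R, (N%:R `^ (- u))%R[) (quad_sum N x y `^ p)%:E <=
   (N%:R `^ (p / 2 - u) + (N%:R `^ (p - 3) + N%:R `^ (p / 2 - u)) * (2048 *
     (N%:R `^ (u - 3) * (3 * N%:R `^ (3 - u) +
      2 * N%:R `^ (1 - u) * (offdiag_sum N N x * offdiag_sum N N x) +
      N%:R `^ (2 - 2 * u) * (offdiag_sum N N x * offdiag_sum N K x)))))%:E)%E.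
Proof.
move=> u0 u1 p0 N2 KN vK dK.
have [K0 KN'] := andP KN.
have N0 : (0 < N)%N by lia.
set n : R := N%:R; set s := offdiag_sum N N x; set t := offdiag_sum N K x.
have n1 : 1 <= n by rewrite ler1n.
have n0 : 0 < n by lra.
have k0 : 0 < K%:R :> R by rewrite ltr0n.
have nD a b : n `^ (a + b) = n `^ a * n `^ b by rewrite powRD // (gt_eqF n0) implybT.
have s0 : 0 <= s by exact: offdiag_sum_ge0.
have t0 : 0 <= t by exact: offdiag_sum_ge0.
have ts : t <= s by exact: offdiag_sum_mono.
have sn : s <= n ^+ 2 by exact: offdiag_sum_le_sqr.
pose A := n `^ (p - (6 - 2 * u)) + n `^ ((p - (6 - 2 * u)) / 2).
pose W := (2 * (n + s)) `^ (2 - u).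
have A0 : 0 <= A by rewrite addr_ge0 ?powR_ge0.
have W0 : 0 <= W by exact: powR_ge0.
pose a := A * W * (2 / K%:R) ^+ 2.
have a0 : 0 <= a by rewrite !mulr_ge0 ?sqr_ge0.
pose g y := (dirichlet K y * quad_sum N x y) ^+ 2.
have mg : measurable_fun setT g.
  apply: measurable_funX; apply: measurable_funM; last exact: measurable_quad_sum_r.
  by have := measurable_dirichlet K (1 : R); under eq_fun do rewrite mul1r.
have g0 y : 0 <= g y by exact: sqr_ge0.
have mB : measurable (`[0, n `^ (- u)[%classic : set R) by [].
have pt y : 0 <= y -> y < n `^ (- u) -> quad_sum N x y `^ p <= n `^ (p / 2) + a * g y.
  move=> y0 yv; set f := quad_sum N x y.
  have f0 : 0 <= f by exact: quad_sum_ge0.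
  apply: le_trans (powR_critical (6 - 2 * u) p0 n1 f0 (quad_sum_le N x y)) _.
  rewrite lerD2l; have -> : a * g y = A * (W * ((2 / K%:R) ^+ 2 * g y)) by rewrite /a !mulrA.
  apply: ler_wpM2l => //.
  have fS : f ^+ 2 <= 2 * (n + s).
    by rewrite -sum_diff_sumE ?N0 ?leqnn //; exact: quad_sum_sqr_le.
  (* The first factor is bounded uniformly in [y] by differencing; the second is kept for the
     [y]-mean. *)
  have -> : f `^ (6 - 2 * u) = (f ^+ 2) `^ (2 - u) * f ^+ 2.
    rewrite -powR_mulrn // -powRrM -powRD; first by congr (_ `^ _); ring.
    by apply/implyP => /eqP h; exfalso; move: h; lra.
  apply: ler_pM; rewrite ?powR_ge0 ?sqr_ge0 //.
    by apply: ge0_ler_powR; rewrite ?nnegrE ?sqr_ge0 //; lra.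
  rewrite /g -exprMn mulrA ler_sqr ?nnegrE ?mulr_ge0 ?divr_ge0 ?dirichlet_ge0 //.
  apply: ler_peMl => //.
  have := dK y y0 (ltW yv); rewrite ler_pdivrMr // => h.
  by rewrite mulrAC ler_pdivlMr // mul1r mulrC.
apply: (@le_trans _ _ (\int[mu]_(y in `[0%R, (n `^ (- u))%R[)
    ((n `^ (p / 2))%:E + a%:E * (g y)%:E))%E).
  apply: ge0_le_integral => //=.
  - by move=> y _; rewrite lee_fin powR_ge0.
  - apply/measurable_EFinP; apply: measurable_funTS.
    by apply: (measurableT_comp (measurable_powR p)); exact: measurable_quad_sum_r.
  - apply/measurable_EFinP; apply: measurable_funTS.
    by apply: measurable_funD => //; apply: measurable_funM.
  - move=> y; rewrite in_itv /= => /andP[y0 yv].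
    by rewrite -EFinM -EFinD lee_fin; exact: pt.
rewrite ge0_integralD //=; last 3 first.
- by move=> y _; rewrite lee_fin powR_ge0.
- by move=> y _; rewrite -EFinM lee_fin mulr_ge0.
- by apply/measurable_EFinP; apply: measurable_funTS; apply: measurable_funM.
rewrite integral_cst //= lebesgue_measure_itv /= lte_fin powR_gt0 //.
rewrite oppr0 adde0 -EFinM -nD ge0_integralZl_EFin //=; last 2 first.
- by move=> y _; rewrite lee_fin.
- by apply/measurable_EFinP; exact: measurable_funTS.
rewrite EFinD; apply: leeD => //.
apply: (@le_trans _ _ (a%:E * (2 * K%:R * (n + t))%:E)%E).
  rewrite lee_wpmul2l ?lee_fin //.
  (* With the kernel as a weight, the interval may be enlarged to a full period, where orthogonality
     applies. *)
  apply: (@le_trans _ _ (\int[mu]_(y in `[0%R, 1%R]) (g y)%:E)%E).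
    apply: ge0_subset_integral => //=.
    - by apply/measurable_EFinP; exact: measurable_funTS.
    - by move=> y _; rewrite lee_fin.
    - move=> y /=; rewrite !in_itv /= => /andP[-> yv] /=.
      apply: ltW; apply: lt_le_trans yv _.
      have : - u <= 0 by lra.
      by move=> /(ler_powR n1); rewrite powRr0.
  by rewrite -sum_diff_sumE //; exact: integral_dirichlet_quad_sum_le.
rewrite -EFinM lee_fin.
have := offdiag_interpolation u0 u1 n1 t0 ts sn.
rewrite -/W [s ^+ 2]expr2; set V := 3 * _ + _ + _ => WV.
have V0 : 0 <= V by rewrite !addr_ge0 ?mulr_ge0 ?powR_ge0.
have -> : a * (2 * K%:R * (n + t)) = 8 * K%:R^-1 * A * (W * (n + t)).
  by rewrite /a; field; rewrite gt_eqF.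
(* At the critical exponent the two terms agree: [A * n ^ (3 - 2 u)] is the claimed sum of powers.
   The constant is [2048 = 128 * 16], with 128 from [8 / K <= 128 n ^ (- u)] and 16 from the
   interpolation. *)
have -> : (n `^ (p - 3) + n `^ (p / 2 - u)) * (2048 * (n `^ (u - 3) * V)) =
   128 * n `^ (- u) * A * (16 * V).
  have -> : n `^ (p - 3) = n `^ (p - (6 - 2 * u)) * n `^ (3 - 2 * u).
    by rewrite -nD; congr (_ `^ _); ring.
  have -> : n `^ (p / 2 - u) = n `^ ((p - (6 - 2 * u)) / 2) * n `^ (3 - 2 * u).
    by rewrite -nD; congr (_ `^ _); field.
  rewrite -mulrDl -/A.
  have -> : n `^ (- u) = n `^ (3 - 2 * u) * n `^ (u - 3).
    by rewrite -nD; congr (_ `^ _); ring.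
  ring.
apply: ler_pM => //; rewrite ?mulr_ge0 ?invr_ge0 //; try lra.
apply: ler_wpM2r => //.
rewrite powRN ler_pdivrMr // mulrAC ler_pdivlMr ?powR_gt0 //.
rewrite -/n in vK; lra.
Qed.

Lemma measurable_fun_integral_r (B : set R) (f : R * R -> \bar R) :
  measurable B -> measurable_fun setT f -> (forall w, (0 <= f w)%E) ->
  measurable_fun setT (fun x => \int[mu]_(y in B) f (x, y))%E.
Proof.
move=> mB mf f0; have mTB := measurableX (@measurableT _ R) mB.
have -> : (fun x => \int[mu]_(y in B) f (x, y))%E = fubini_F mu (f \_ (setT `*` B)).
  apply/funext => x; rewrite /fubini_F [LHS]integral_mkcond; apply: eq_integral => y _.
  by rewrite !patchE in_setX in_setT.
apply: measurable_fun_fubini_tonelli_F.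
- by apply/(measurable_restrictT _ mTB); exact: measurable_funTS.
- by move=> w; apply: erestrict_ge0.
Qed.

End MeanValue.

(** * Integration over the leading coefficient and choice of the constant *)

Theorem theorem1p2 (R : realType) (u p eps : R) :
  0 < u -> u <= 1 -> 0 < p -> 0 < eps ->
  exists2 C : R, 0 < C &
    forall N : nat, (2 <= N)%N ->
      (mean_value2 p u N <=
       (C * (N%:R `^ eps * (N%:R `^ (p - 3) + N%:R `^ (p / 2 - u))))%:E)%E.
Proof.
move=> u0 u1 p0 e0.
(* The harmonic sum enters to the fourth power, so each factor may cost [n ^ (eps / 4)]. *)
pose c : R := 1 + (eps / 4)^-1.
have c1 : 1 <= c by rewrite lerDl invr_ge0 divr_ge0 // ltW.
have [a aE] : exists a : R, a = 2048 by exists 2048.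
have [b bE] : exists b : R, b = 1024 by exists 1024.
have a0 : 0 <= a by rewrite aE; exact: ler0n.
have b0 : 0 <= b by rewrite bE; exact: ler0n.
(* The 1 pays for [n ^ (p / 2 - u)], [3 a] for the constant term, and [3 a b] for the mean of
   [S ^ 2], with coefficient 2, and that of [S T], with coefficient 1. *)
exists (1 + a * (3 + 3 * b) * c ^+ 4).
  apply: ltr_pwDl => //; apply: mulr_ge0; last by apply: exprn_ge0; lra.
  by rewrite mulr_ge0 // addr_ge0 // mulr_ge0.
move=> N N2.
have [K [KN Kv vK dK]] := exists_window u0 u1 N2.
have N0 : (0 < N)%N by exact: ltnW.
set n : R := N%:R.
have n1 : 1 <= n by rewrite ler1n.
have n0 : 0 < n by exact: lt_le_trans ltr01 n1.
have nD v w : n `^ (v + w) = n `^ v * n `^ w by rewrite powRD // (gt_eqF n0) implybT.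
pose L := harmonic_sum R N.
have L1 : 1 <= L by exact: harmonic_sum_ge1.
have Lc : L ^+ 4 <= c ^+ 4 * n `^ eps.
  have -> : n `^ eps = (n `^ (eps / 4)) ^+ 4.
    by rewrite -powR_mulrn ?powR_ge0 // -powRrM; congr (_ `^ _); field.
  rewrite -exprMn; apply: lerXn2r; rewrite ?nnegrE.
  - exact: le_trans ler01 L1.
  - by apply: mulr_ge0; [exact: le_trans ler01 c1 | exact: powR_ge0].
  - by apply: harmonic_sum_le_powR => //; rewrite divr_gt0.
set X := n `^ (p - 3) + n `^ (p / 2 - u).
have X0 : 0 <= X by rewrite addr_ge0 ?powR_ge0.
pose B := n `^ (p / 2 - u).
have B0 : 0 <= B by exact: powR_ge0.
pose S2 (x : R) := offdiag_sum N N x * offdiag_sum N N x.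
pose ST (x : R) := offdiag_sum N N x * offdiag_sum N K x.
have S20 x : 0 <= S2 x by rewrite mulr_ge0 ?offdiag_sum_ge0.
have ST0 x : 0 <= ST x by rewrite mulr_ge0 ?offdiag_sum_ge0.
have mS2 : measurable_fun setT S2 by apply: measurable_funM; exact: measurable_offdiag_sum.
have mST : measurable_fun setT ST by apply: measurable_funM; exact: measurable_offdiag_sum.
(* [c0], [d1] and [d2] are the coefficients of 1, [S ^ 2] and [S T] once [n ^ (u - 3)] is multiplied
   out in [short_integral_le]. *)
pose c0 := B + X * a * 3.
pose d1 := X * a * 2 * n `^ (- 2).
pose d2 := X * a * n `^ (- 1 - u).
have c00 : 0 <= c0 by rewrite addr_ge0 ?mulr_ge0.
have d10 : 0 <= d1 by rewrite !mulr_ge0 ?powR_ge0.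
have d20 : 0 <= d2 by rewrite !mulr_ge0 ?powR_ge0.
pose f (w : R * R) := (quad_sum N w.1 w.2 `^ p)%:E.
have mf : measurable_fun setT f.
  apply/measurable_EFinP; apply: (measurableT_comp (measurable_powR p)).
  exact: measurable_quad_sum.
have f0 w : (0 <= f w)%E by rewrite lee_fin powR_ge0.
have mU : measurable (`[0, 1[%classic : set R) by [].
have mV : measurable (`[0, n `^ (- u)[%classic : set R) by [].
have -> : mean_value2 p u N =
    (\int[lebesgue_measure]_(x in `[0%R, 1%R[)
       \int[lebesgue_measure]_(y in `[0%R, (n `^ (- u))%R[) f (x, y))%E.
  rewrite -(integral_setX mU mV mf f0) /mean_value2 /short_box2.
  by congr (integral _ _ _); apply/funext => -[x y]; rewrite normc_weyl_sum2.
have mI : measurable (`[0, 1]%classic : set R) by [].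
apply: (@le_trans _ _ (\int[lebesgue_measure]_(x in `[0%R, 1%R])
   (c0%:E + (d1%:E * (S2 x)%:E + d2%:E * (ST x)%:E)))%E).
  apply: (@le_trans _ _ (\int[lebesgue_measure]_(x in `[0%R, 1%R[)
   (c0%:E + (d1%:E * (S2 x)%:E + d2%:E * (ST x)%:E)))%E).
    apply: ge0_le_integral => //.
    - by move=> x _; apply: integral_ge0.
    - by apply: measurable_funTS; exact: measurable_fun_integral_r.
    - apply/measurable_EFinP; apply: measurable_funTS.
      by apply: measurable_funD => //; apply: measurable_funD; apply: measurable_funM.
    - move=> x _; have := short_integral_le x u0 u1 p0 N2 KN vK dK.
      rewrite -aE => /le_trans; apply.
      rewrite -!EFinM -!EFinD lee_fin -/n -/X -/B -/(S2 x) -/(ST x).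
      rewrite le_eqVlt; apply/orP; left; apply/eqP.
      have E0 : n `^ (u - 3) * n `^ (3 - u) = 1.
        by rewrite -nD -(powRr0 n); congr (_ `^ _); ring.
      have E1 : n `^ (u - 3) * n `^ (1 - u) = n `^ (- 2).
        by rewrite -nD; congr (_ `^ _); ring.
      have E2 : n `^ (u - 3) * n `^ (2 - 2 * u) = n `^ (- 1 - u).
        by rewrite -nD; congr (_ `^ _); ring.
      have E3 : X * a * 3 = X * a * 3 * (n `^ (u - 3) * n `^ (3 - u)) by rewrite E0 mulr1.
      rewrite /c0 E3 /d1 /d2 -E1 -E2; ring.
  apply: ge0_subset_integral => //=.
  - apply/measurable_EFinP; apply: measurable_funTS.
    by apply: measurable_funD => //; apply: measurable_funD; apply: measurable_funM.
  - by move=> x _; rewrite -!EFinM -!EFinD lee_fin; apply: addr_ge0 => //;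
      by apply: addr_ge0; apply: mulr_ge0.
  - by move=> x /=; rewrite !in_itv /= => /andP[-> /ltW ->].
have mdS2 : measurable_fun (`[0, 1]%classic : set R) (fun x => d1%:E * (S2 x)%:E)%E.
  by apply/measurable_EFinP; apply: measurable_funTS; apply: measurable_funM.
have mdST : measurable_fun (`[0, 1]%classic : set R) (fun x => d2%:E * (ST x)%:E)%E.
  by apply/measurable_EFinP; apply: measurable_funTS; apply: measurable_funM.
have dS20 x : (0 <= d1%:E * (S2 x)%:E)%E by rewrite -EFinM lee_fin mulr_ge0.
have dST0 x : (0 <= d2%:E * (ST x)%:E)%E by rewrite -EFinM lee_fin mulr_ge0.
rewrite ge0_integralD //=; last 2 first.
- by move=> x _; exact: adde_ge0.
- exact: emeasurable_funD.
rewrite ge0_integralD //= integral_cst //= lebesgue_measure_itv /= lte_fin ltr01.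
rewrite oppr0 adde0 mule1 !ge0_integralZl_EFin //=; last 4 first.
- by move=> x _; rewrite lee_fin.
- by apply/measurable_EFinP; exact: measurable_funTS.
- by move=> x _; rewrite lee_fin.
- by apply/measurable_EFinP; exact: measurable_funTS.
have I1 := integral_offdiag_sum2_le R N N0; rewrite -bE in I1.
have I2 := integral_offdiag_sum2_le R K N0; rewrite -bE in I2.
apply: (@le_trans _ _ (c0%:E + (d1%:E * (b * n * n * L ^+ 4)%:E +
   d2%:E * (b * n * K%:R * L ^+ 4)%:E))%E).
  by rewrite leeD2l //; apply: leeD; apply: lee_wpmul2l; rewrite ?lee_fin.
rewrite -!EFinM -!EFinD lee_fin.
have E1 : n `^ (- 2) * (n * n) = 1.
  by rewrite -expr2 powR_invn ?ltW // mulVf // expf_neq0 // gt_eqF.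
have E2 : n `^ (- 1 - u) * (n * n `^ u) = 1.
  have -> : n * n `^ u = n `^ (1 + u) by rewrite nD powRr1 // ltW.
  by rewrite -nD -(powRr0 n); congr (_ `^ _); ring.
have L41 : 1 <= L ^+ 4 by exact: exprn_ege1.
(* The bound [K <= n ^ u] makes the mean of [S T] cancel [n ^ (- 1 - u)]. *)
have H2 : d2 * (b * n * K%:R * L ^+ 4) <= X * a * b * L ^+ 4.
  apply: (@le_trans _ _ (d2 * (b * n * n `^ u * L ^+ 4))).
    apply: ler_wpM2l => //; apply: ler_wpM2r; first lra.
    by apply: ler_wpM2l => //; apply: mulr_ge0 => //; exact: ltW.
  have -> : d2 * (b * n * n `^ u * L ^+ 4) =
      X * a * b * L ^+ 4 * (n `^ (- 1 - u) * (n * n `^ u)) by rewrite /d2; ring.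
  by rewrite E2 mulr1.
have H1 : d1 * (b * n * n * L ^+ 4) = X * a * 2 * b * L ^+ 4.
  have -> : d1 * (b * n * n * L ^+ 4) =
      X * a * 2 * b * L ^+ 4 * (n `^ (- 2) * (n * n)) by rewrite /d1; ring.
  by rewrite E1 mulr1.
have BX : B <= X by rewrite lerDr powR_ge0.
have XL : X <= X * L ^+ 4 by rewrite ler_peMr.
have n1e : 1 <= n `^ eps by have := ler_powR n1 (ltW e0); rewrite powRr0.
have BXe : B <= n `^ eps * X by apply: le_trans BX _; rewrite ler_peMl.
have XLc : X * L ^+ 4 <= X * (c ^+ 4 * n `^ eps) by apply: ler_wpM2l.
rewrite H1 /c0 [leRHS]mulrDl mul1r.
have -> : a * (3 + 3 * b) * c ^+ 4 * (n `^ eps * X) =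
  3 * a * (X * (c ^+ 4 * n `^ eps)) + 3 * (a * b) * (X * (c ^+ 4 * n `^ eps)) by ring.
have A1 : 3 * a * X <= 3 * a * (X * (c ^+ 4 * n `^ eps)).
  by apply: ler_wpM2l; [lra | exact: le_trans XL XLc].
have A2 : 3 * (a * b) * (X * L ^+ 4) <= 3 * (a * b) * (X * (c ^+ 4 * n `^ eps)).
  by apply: ler_wpM2l => //; rewrite !mulr_ge0.
lra.
Qed.
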